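(* Let $X$ be a real Hilbert space and let $A,B$ be closed convex nonempty subsets of $X$ such that $E$ and $F$ are (nonempty and) bounded. Suppose that the couple $(A,B)$ is regular. Then the couple $(A,B)$ is $d$-stable.
   Context: $P_C$ is the metric projection onto a closed convex nonempty set $C$; $B_X$ the closed unit ball; $\mathrm{dist}(x,S)=\inf_{s\in S}\|x-s\|$, $\mathrm{dist}(S,T)=\inf_{s\in S}\mathrm{dist}(s,T)$. $E=\{a\in A:\mathrm{dist}(a,B)=\mathrm{dist}(A,B)\}$, $F=\{b\in B:\mathrm{dist}(b,A)=\mathrm{dist}(A,B)\}$, $v=P_{\overline{B-A}}(0)$ (projection of $0$ onto the closure of $B-A$). The couple $(A,B)$ (with $E,F$ nonempty) is regular if for each $\epsilon>0$ there is $\delta>0$ such that $\mathrm{dist}(x,E)\le\epsilon$ whenever $x\in X$ and $\max\{\mathrm{dist}(x,A),\mathrm{dist}(x,B-v)\}\le\delta$. Attouch–Wets convergence: for nonempty closed $C,D$ and $N\in\mathbb N$ let $e_N(C,D)=\sup_{c\in C\cap NB_X}\mathrm{dist}(c,D)$ ($0$ if $C\cap NB_X=\emptyset$) and $h_N(C,D)=\max\{e_N(C,D),e_N(D,C)\}$; $C_j\to C$ if $\lim_j h_N(C_j,C)=0$ for every $N\in\mathbb N$. Given sequences $\{A_n\},\{B_n\}$ of closed convex nonempty sets and $a_0\in X$, the perturbed alternating projections sequences are defined by $b_n=P_{B_n}(a_{n-1})$ and $a_n=P_{A_n}(b_n)$ for $n\in\mathbb N$. The couple $(A,B)$ (with $E,F$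 nonempty) is $d$-stable if for every choice of sequences $\{A_n\},\{B_n\}$ of closed convex nonempty sets converging in the Attouch–Wets sense to $A$ and $B$ respectively, and every starting point $a_0\in X$, the corresponding perturbed alternating projections sequences satisfy $\mathrm{dist}(a_n,E)\to0$ and $\mathrm{dist}(b_n,F)\to0$. *)

(* Defs.v *)
From HB Require Import structures.
From mathcomp Require Import all_boot all_order all_algebra.
From mathcomp Require Import all_classical all_reals all_analysis.
Set Implicit Arguments. Unset Strict Implicit. Unset Printing Implicit Defensive.
Import Order.TTheory GRing.Theory Num.Theory.
Import numFieldNormedType.Exports.
Local Open Scope classical_set_scope.
Local Open Scope ring_scope.

Section Defs.
Context {R : realType} {V : normedModType R}.

(* Real Hilbert space structure: [ip] is a symmetric bilinear form whose
   induced norm is the norm of V; completeness comes from V being a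
   completeNormedModType (see the theorem statement). *)
Definition is_inner_product (ip : V -> V -> R) : Prop :=
  [/\ (forall x y, ip x y = ip y x),
      (forall (a : R) x y z, ip (a *: x + y) z = a * ip x z + ip y z)
    & (forall x, ip x x = `|x| ^+ 2)].

Definition convex_set (C : set V) : Prop :=
  forall x y (t : R), C x -> C y -> 0 <= t -> t <= 1 ->
    C (t *: x + (1 - t) *: y).

Definition ccn (C : set V) : Prop := [/\ closed C, convex_set C & C !=set0].

Definition distp (x : V) (S : set V) : R := inf [set `|x - s| | s in S].
Definition dists (S T : set V) : R := inf [set distp s T | s in S].

(* metric projection: the (unique, in a Hilbert space, for C closed convex
   nonempty) nearest point of C to x *)
Definition is_nearest (C : set V) (x p : V) : Prop :=
  C p /\ forall c, C c -> `|x - p| <= `|x - c|.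
Definition proj (C : set V) (x : V) : V := xget 0 (is_nearest C x).

Definition Eset (A B : set V) : set V := [set a | A a /\ distp a B = dists A B].
Definition Fset (A B : set V) : set V := [set b | B b /\ distp b A = dists A B].

Definition setdiff (B A : set V) : set V := [set b - a | b in B & a in A].
Definition vdisp (A B : set V) : V := proj (closure (setdiff B A)) 0.
Definition translate (B : set V) (v : V) : set V := [set b - v | b in B].

Definition regular (A B : set V) : Prop :=
  forall eps : R, 0 < eps -> exists2 delta : R, 0 < delta &
    forall x : V, Num.max (distp x A) (distp x (translate B (vdisp A B))) <= delta ->
      distp x (Eset A B) <= eps.

Definition excessN (N : nat) (C D : set V) : R :=
  sup [set distp c D | c in C `&` [set y | `|y| <= N%:R]].
Definition hN (N : nat) (C D : set V) : R := Num.max (excessN N C D) (excessN N D C).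
Definition AW_cvg (Cs : nat -> set V) (C : set V) : Prop :=
  forall N : nat, hN N (Cs j) C @[j --> \oo] --> 0.

(* perturbed alternating projections: b_n = P_{B_n}(a_{n-1}), a_n = P_{A_n}(b_n),
   n >= 1 (b 0 is unused) *)
Definition pap_seq (As Bs : nat -> set V) (a0 : V) (a b : nat -> V) : Prop :=
  a 0%N = a0 /\ forall n : nat,
    b n.+1 = proj (Bs n.+1) (a n) /\ a n.+1 = proj (As n.+1) (b n.+1).

Definition d_stable (A B : set V) : Prop :=
  forall (As Bs : nat -> set V), (forall n, ccn (As n)) -> (forall n, ccn (Bs n)) ->
    AW_cvg As A -> AW_cvg Bs B ->
    forall (a0 : V) (a b : nat -> V), pap_seq As Bs a0 a b ->
      distp (a n) (Eset A B) @[n --> \oo] --> 0 /\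
      distp (b n) (Fset A B) @[n --> \oo] --> 0.
End Defs.

(* Main.v *)
(* Fix e in E, so that e + v in F is the nearest point of B to e, and e the
   nearest point of A to e + v.  Nearest points depend continuously on the set
   for the Attouch-Wets convergence, so the perturbed projections almost fix
   this pair, and by firm nonexpansiveness a step x -> b -> a decreases
   |x - e|^2 by about |b - a - v|^2.  If this gap is small, then a is close to
   both A and B - v, hence to E by regularity.  Thus at each step either the
   distance to E is already small, or it decreases by a fixed amount.  The same
   dichotomy, applied to iterates scaled back towards e, first shows that the
   iterates are eventually bounded. *)

Require Import Defs.
From HB Require Import structures.
From mathcomp Require Import all_boot all_order all_algebra.
From mathcomp Require Import all_classical all_reals all_analysis.
From mathcomp Require Import ring lra.
Set Implicit Arguments. Unset Strict Implicit. Unset Printing Implicit Defensive.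
Import Order.TTheory GRing.Theory Num.Theory.
Import numFieldNormedType.Exports.
Local Open Scope classical_set_scope.
Local Open Scope ring_scope.

(** Supplies tolerances: one number that stays below [eps] also after multiplication by [a];
    [s <= 1] lets [s ^+ 2] be absorbed into [s]. *)
Lemma small_scale {R : realType} (a eps : R) : 0 < a -> 0 < eps ->
  exists s, [/\ 0 < s, s <= 1, s <= eps & s * a <= eps].
Proof.
move=> a0 e0; exists (Num.min 1 (Num.min eps (eps / a))).
split; first by rewrite !lt_min ltr01 e0 divr_gt0.
- by rewrite ge_min lexx.
- by rewrite !ge_min lexx orbT.
- by rewrite -ler_pdivlMr// !ge_min lexx !orbT.
Qed.

(** * Distance from a point to a set *)

Section Distances.
Context {R : realType} {X : normedModType R}.
Implicit Types (x y u w : X) (S T : set X).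

Lemma norm_dist_triangle y x z : `|x - z| <= `|x - y| + `|y - z|.
Proof. by rewrite -(subrKA y); exact: ler_normD. Qed.

Lemma distp_le x S s : S s -> distp x S <= `|x - s|.
Proof.
move=> Ss; apply: ge_inf; last by exists s.
by exists 0 => _ [t _ <-].
Qed.

Lemma distp_ge x S (m : R) : S !=set0 -> (forall s, S s -> m <= `|x - s|) ->
  m <= distp x S.
Proof.
move=> [s Ss] h; apply: lb_le_inf; first by exists `|x - s|, s.
by move=> _ [t /h ? <-].
Qed.

Lemma distp_ge0 x S : S !=set0 -> 0 <= distp x S.
Proof. by move=> S0; apply: distp_ge => // s _. Qed.

Lemma distp_adherent x S (eps : R) : S !=set0 -> 0 < eps ->
  exists2 s, S s & `|x - s| <= distp x S + eps.
Proof.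
move=> [s Ss] e0.
have [|_ [t St <-] /ltW ?] := @inf_adherent R [set `|x - s| | s in S] eps e0.
  by split; [exists `|x - s|, s | exists 0 => _ [t _ <-]].
by exists t.
Qed.

Lemma dists_le S T s t : S s -> T t -> dists S T <= `|s - t|.
Proof.
move=> Ss Tt; apply: le_trans _ (distp_le s Tt); apply: ge_inf; last by exists s.
by exists 0 => _ [u _ <-]; apply: distp_ge0; exists t.
Qed.

End Distances.

(** * Attouch-Wets convergence by approximating points *)

Section AttouchWets.
Context {R : realType} {X : normedModType R}.
Implicit Types (C D : set X).

(** The supremum is a genuine one: for any [d] in [D], all these distances are at most [N + |d|]. *)
Lemma distp_le_excessN (N : nat) C D c : D !=set0 -> C c -> `|c| <= N%:R ->
  distp c D <= excessN N C D.
Proof.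
move=> [d Dd] Cc cN; apply: ub_le_sup; last by exists c.
exists (N%:R + `|d|) => _ [u [_ /= uN] <-].
apply: le_trans (distp_le u Dd) _.
by apply: le_trans (ler_normB _ _) _; rewrite lerD2r.
Qed.

(** Half of [eps] bounds [hN] for an integer [N] above [M]; the other half pays for an infimum that
    may not be attained. *)
Lemma AW_cvg_near (Cs : nat -> set X) C (M eps : R) :
  C !=set0 -> (forall n, Cs n !=set0) -> AW_cvg Cs C -> 0 < eps ->
  \forall n \near \oo,
    (forall c, Cs n c -> `|c| <= M -> exists2 c', C c' & `|c - c'| <= eps) /\
    (forall c, C c -> `|c| <= M -> exists2 c', Cs n c' & `|c - c'| <= eps).
Proof.
move=> C0 Cs0 CsC e0; set N := (Num.truncn M).+1.
have /cvgrPdist_lt /(_ (eps / 2)) := CsC N; rewrite divr_gt0// => /(_ isT) near_h.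
near=> n.
have h_small : hN N (Cs n) C < eps / 2.
  apply: le_lt_trans (ler_norm _) _; rewrite -normrN -sub0r; near: n.
  exact: near_h.
have close (S T : set X) c : S !=set0 -> T !=set0 -> excessN N S T <= hN N (Cs n) C ->
    S c -> `|c| <= M -> exists2 c', T c' & `|c - c'| <= eps.
  move=> S0 T0 le_h Sc cM.
  have [t Tt ct] : exists2 t, T t & `|c - t| <= distp c T + eps / 2.
    by apply: distp_adherent => //; lra.
  exists t => //.
  have : distp c T <= excessN N S T.
    by apply: distp_le_excessN => //; apply: (le_trans cM); exact/ltW/truncnS_gt.
  by lra.
by split=> c; apply: close => //; rewrite /hN le_max lexx ?orbT.
Unshelve. all: by end_near. Qed.

End AttouchWets.

(** * Inner product calculus *)

Section Hilbert.
Context {R : realType} {X : completeNormedModType R} {ip : X -> X -> R}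
  (hip : is_inner_product ip).
Implicit Types (x y u w p q c : X) (C : set X).

Lemma ipC x y : ip x y = ip y x. Proof. by case: hip. Qed.

Lemma ip_norm x : ip x x = `|x| ^+ 2. Proof. by case: hip. Qed.

Lemma ipDl x y z : ip (x + y) z = ip x z + ip y z.
Proof. by case: hip => _ /(_ 1 x y z) + _; rewrite scale1r mul1r. Qed.

Lemma ip0l z : ip 0 z = 0.
Proof. by have := ipDl 0 0 z; rewrite addr0; lra. Qed.

Lemma ipZl (a : R) x z : ip (a *: x) z = a * ip x z.
Proof. by case: hip => _ /(_ a x 0 z) + _; rewrite addr0 ip0l addr0. Qed.

Lemma ipNl x z : ip (- x) z = - ip x z.
Proof. by rewrite -scaleN1r ipZl mulN1r. Qed.

Lemma ipDr x y z : ip z (x + y) = ip z x + ip z y.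
Proof. by rewrite ipC ipDl !(ipC z). Qed.

Lemma ipNr x z : ip z (- x) = - ip z x.
Proof. by rewrite ipC ipNl ipC. Qed.

Lemma ipZr (a : R) x z : ip z (a *: x) = a * ip z x.
Proof. by rewrite ipC ipZl ipC. Qed.

Definition ipE := (ipDl, ipDr, ipNl, ipNr, ipZl, ipZr).

(** * Metric projections in a Hilbert space *)

(** Parallelogram law for [x - u] and [x - w]: the midpoint of [u] and [w] lies in [C], hence at
    distance at least [d] from [x]. *)
Lemma near_minimizers_close C x u w (d s : R) : Defs.convex_set C -> C u -> C w ->
  0 <= d -> (forall c, C c -> d <= `|x - c|) ->
  `|x - u| <= d + s -> `|x - w| <= d + s ->
  `|u - w| ^+ 2 <= 4 * ((d + s) ^+ 2 - d ^+ 2).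
Proof.
move=> cC Cu Cw d0 hd xu xw.
have {hd} hm : d <= `|x - (2^-1 *: u + (1 - 2^-1) *: w)|.
  by apply: hd; apply: cC => //; lra.
have hm2 : d ^+ 2 <= `|x - (2^-1 *: u + (1 - 2^-1) *: w)| ^+ 2.
  by rewrite ler_sqr ?nnegrE//; exact: le_trans hm.
have xu2 : `|x - u| ^+ 2 <= (d + s) ^+ 2.
  by rewrite ler_sqr ?nnegrE//; exact: le_trans xu.
have xw2 : `|x - w| ^+ 2 <= (d + s) ^+ 2.
  by rewrite ler_sqr ?nnegrE//; exact: le_trans xw.
move: hm2 xu2 xw2; rewrite -!ip_norm !ipE (ipC u x) (ipC w x) (ipC w u); lra.
Qed.

(** A minimizing sequence is Cauchy by [near_minimizers_close], and its limit stays in the closed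
    set [C]. *)
Lemma nearest_exists C x : ccn C -> exists p, is_nearest C x p.
Proof.
move=> [clC cC C0]; set d := distp x C.
have d0 : 0 <= d by exact: distp_ge0.
have dle c : C c -> d <= `|x - c| by exact: distp_le.
have /choice [u hu] : forall n : nat, exists u, C u /\ `|x - u| <= d + n.+1%:R^-1.
  move=> n; have [|u Cu xu] := @distp_adherent _ _ x C n.+1%:R^-1 C0.
    by rewrite invr_gt0.
  by exists u.
have hcv : cvgn u.
  apply: cauchy_cvg; apply: cauchy_exP => eps e0.
  (* For [s <= 1], 4((d + s)^2 - d^2) <= 4s(2d + 1), which this choice makes smaller than
     [eps ^+ 2]. *)
  pose s := Num.min 1 (eps ^+ 2 / (4 * (4 * d + 4))).
  have s0 : 0 < s by rewrite lt_min ltr01 divr_gt0 ?exprn_gt0// ; lra.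
  have s1 : s <= 1 by rewrite ge_min lexx.
  have seps : s * (4 * (4 * d + 4)) <= eps ^+ 2.
    by rewrite -ler_pdivlMr; [rewrite ge_min lexx orbT | lra].
  have [n _ hn] := near_infty_natSinv_lt (PosNum s0).
  exists (u n); exists n => // m /= nm; rewrite -ball_normE /=.
  have us k : (n <= k)%N -> `|x - u k| <= d + s.
    move=> nk; have [_ xuk] := hu k; apply: (le_trans xuk).
    by rewrite lerD2l; exact/ltW/hn.
  have [Cn _] := hu n; have [Cm _] := hu m.
  have := @near_minimizers_close C x (u n) (u m) d s cC Cn Cm d0 dle
    (us _ (leqnn _)) (us _ nm).
  rewrite -ltr_sqr ?nnegrE//; last exact: ltW.
  move=> h; apply: le_lt_trans h _; apply: lt_le_trans seps; nra.
have Cl : C (lim (u @ \oo)).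
  by apply: (closed_cvg _ clC _ _ hcv); apply: nearW => n; case: (hu n).
exists (lim (u @ \oo)); split=> // c Cc; apply: le_trans _ (dle _ Cc).
apply/ler_addgt0Pr => eps e0; have e2 : 0 < eps / 2 by lra.
near \oo => n.
apply: le_trans (norm_dist_triangle (u n) _ _) _.
have h1 : `|u n - lim (u @ \oo)| <= eps / 2.
  rewrite distrC; near: n; move/cvgrPdist_le : hcv; apply; lra.
have h2 : n.+1%:R^-1 < eps / 2.
  near: n; exact: (near_infty_natSinv_lt (PosNum e2)).
have [_ xun] := hu n; move: (n.+1%:R^-1) h1 h2 xun => r; lra.
Unshelve. all: by end_near. Qed.

Lemma projP C x : ccn C -> is_nearest C x (Defs.proj C x).
Proof. by move=> /(@nearest_exists C x) h; exact: (xgetPex 0 h). Qed.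

(** Otherwise a short move from [p] towards [c], staying in [C], would come closer to [x]. *)
Lemma nearest_obtuse C x p c : Defs.convex_set C -> is_nearest C x p -> C c ->
  ip (x - p) (c - p) <= 0.
Proof.
move=> cC [Cp hp] Cc; rewrite leNgt; apply/negP => k0.
set k := ip (x - p) (c - p) in k0.
pose m := `|c - p| ^+ 2; have m0 : 0 <= m by exact: exprn_ge0.
(* The move by [t] changes the squared distance by t(tm - 2k), negative since tm < k. *)
pose t := k / (m + k); have mk : 0 < m + k by lra.
have t0 : 0 < t by exact: divr_gt0.
have tmk : t * (m + k) = k by rewrite /t; field; lra.
have t1 : t <= 1 by rewrite /t ler_pdivrMr// mul1r; lra.
have := hp _ (cC _ _ t Cc Cp (ltW t0) t1).
have -> : x - (t *: c + (1 - t) *: p) = (x - p) - t *: (c - p).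
  rewrite scalerBr scalerBl scale1r opprD !opprB -addrA; congr (_ + _).
  by rewrite (addrC _ (- p)) addrCA (addrC (- (t *: c))).
rewrite -ler_sqr ?nnegrE//.
have -> : `|x - p - t *: (c - p)| ^+ 2 = `|x - p| ^+ 2 - 2 * t * k + t ^+ 2 * m.
  rewrite /m /k; move: (x - p) (c - p) => y z.
  by rewrite -!ip_norm !ipE (ipC z y); ring.
clearbody t m k => h.
nra.
Qed.

(** The sum of the two obtuse-angle inequalities says that [p - q] and [(x - p) - (y - q)] have
    nonnegative inner product; their sum is [x - y]. *)
Lemma nearest_firmly_nonexpansive C x y p q : Defs.convex_set C -> is_nearest C x p ->
  is_nearest C y q ->
  `|p - q| ^+ 2 <= `|x - y| ^+ 2 - `|(x - p) - (y - q)| ^+ 2.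
Proof.
move=> cC xp yq; have [Cp _] := xp; have [Cq _] := yq.
have := nearest_obtuse cC xp Cq; have := nearest_obtuse cC yq Cp.
rewrite -!ip_norm !ipE (ipC y x) (ipC q p) (ipC p x) (ipC p y) (ipC q x) (ipC q y).
lra.
Qed.

(** * Stability of projections under Attouch-Wets convergence *)

(** A point [p'] of [C] close to [p] almost minimizes the distance to [x], because [p] does at least
    as well as a point of [Cs n] close to [u]. Hence [p'] is close to [u], uniformly on the ball. *)
Lemma projection_AW (Cs : nat -> set X) C (M eps : R) :
  ccn C -> (forall n, ccn (Cs n)) -> AW_cvg Cs C -> 0 <= M -> 0 < eps ->
  \forall n \near \oo, forall x u p, `|x| <= M -> `|u| <= M ->
    is_nearest C x u -> is_nearest (Cs n) x p -> `|p - u| <= eps.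
Proof.
move=> [_ cC C0] hCs CsC M0 e0.
have Cs0 n : Cs n !=set0 by case: (hCs n).
have eps2 : 0 < eps ^+ 2 / 4 by rewrite divr_gt0 ?exprn_gt0.
(* [h] is the allowed excess of |x - p'| over |x - u| <= 2M; the approximation error [k] below
   enters it twice. *)
have [|h [h0 h1 _ hM]] := @small_scale R (16 * (2 * M + 1)) _ _ eps2; first lra.
have min0 : 0 < Num.min h (eps / 2) by rewrite lt_min h0 divr_gt0.
have [//|k [k0 _ keps kh]] := @small_scale R 2 _ _ min0.
move: keps kh; rewrite !le_min => /andP[_ keps] /andP[kh _].
apply: filterS (AW_cvg_near (3 * M + 1) C0 Cs0 CsC k0).
move=> n [CsnC CCsn] x u p xM uM [Cu hu] [Cp hp].
have xu : `|x - u| <= 2 * M by apply: le_trans (ler_normB _ _) _; lra.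
have [|u' Cu' uu'] := CCsn u Cu; first lra.
have xp : `|x - p| <= `|x - u| + k.
  by apply: le_trans (hp _ Cu') _; apply: le_trans (norm_dist_triangle u _ _) _; lra.
have [|p' Cp' pp'] := CsnC p Cp.
  have := ler_normB x (x - p); rewrite subKr; lra.
have xp' : `|x - p'| <= `|x - u| + h.
  by apply: le_trans (norm_dist_triangle p _ _) _; lra.
have := near_minimizers_close cC Cp' Cu (normr_ge0 _) hu xp' _.
rewrite lerDl => /(_ (ltW h0)) up'.
have : `|p' - u| <= eps / 2.
  rewrite -ler_sqr ?nnegrE//; last by lra.
  have := normr_ge0 (x - u).
  rewrite exprMn exprVn; nra.
have := norm_dist_triangle p' p u; lra.
Qed.

(** * The displacement vector *)

Lemma convex_setdiff (A B : set X) :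
  Defs.convex_set A -> Defs.convex_set B -> Defs.convex_set (setdiff B A).
Proof.
move=> cA cB _ _ t [b Bb [a Aa <-]] [b' Bb' [a' Aa' <-]] t0 t1.
exists (t *: b + (1 - t) *: b'); first exact: cB.
exists (t *: a + (1 - t) *: a'); first exact: cA.
by rewrite !scalerBr opprD addrACA.
Qed.

(** If [f] is the projection of [e] onto [B], then [f - e] attains the minimal norm on [B - A];
    uniqueness of the minimizer identifies it with [vdisp A B]. *)
Lemma Eset_vdisp (A B : set X) e : ccn A -> ccn B -> Eset A B e ->
  [/\ is_nearest B e (e + vdisp A B), is_nearest A (e + vdisp A B) e
    & Fset A B (e + vdisp A B)].
Proof.
move=> hA hB [Ae eB]; have [clA cA A0] := hA; have [clB cB B0] := hB.
have [Bf hf] := projP e hB; set f := Defs.proj B e in Bf hf.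
set d := dists A B in eB *.
have AB a b : A a -> B b -> d <= `|a - b| by exact: dists_le.
have ef : `|e - f| = d.
  by apply/eqP; rewrite eq_le AB// -eB andbT; exact: distp_ge.
have d0 : 0 <= d by rewrite -ef.
have Dfe : setdiff B A (f - e) by exists f => //; exists e.
have hD w : setdiff B A w -> d <= `|0 - w|.
  by move=> [b Bb [a Aa <-]]; rewrite sub0r opprB AB.
have fe : `|0 - (f - e)| = d by rewrite sub0r opprB.
have [clv hv] : is_nearest (closure (setdiff B A)) 0 (vdisp A B).
  apply: (@xgetPex _ 0 (is_nearest (closure (setdiff B A)) 0)).
  exists (f - e); split; first exact: subset_closure.
  move=> w clw; rewrite fe; apply/ler_addgt0Pr => r r0.
  have [w' [Dw']] := clw _ (nbhsx_ballx w r r0).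
  rewrite -ball_normE /= => ww'; apply: le_trans (hD _ Dw') _.
  by apply: le_trans (norm_dist_triangle w _ _) _; lra.
suff vE : vdisp A B = f - e.
  rewrite vE addrC subrK; split.
  - by [].
  - by split=> // a Aa; rewrite distrC ef distrC AB.
  - split=> //; apply/eqP; rewrite eq_le -/d -{1}ef distrC distp_le//=.
    by apply: distp_ge => // a Aa; rewrite distrC AB.
apply/eqP; rewrite -subr_eq0 -normr_le0 leNgt; apply/negP.
set r := `|_| => r0.
(* If the two minimizers differ by [r > 0], a point [w] of [B - A] within r/4 of [vdisp A B] almost
   minimizes the norm, hence is within r/2 of [f - e]: a contradiction. *)
have r2 : 0 < Num.min (r / 4) (r ^+ 2 / 8) by rewrite lt_min !divr_gt0 ?exprn_gt0.
have [|s [s0 s1 + +]] := @small_scale R (4 * (2 * d + 1)) _ _ r2; first lra.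
rewrite !le_min => /andP[sr _] /andP[_ sd].
have [w [Dw]] := clv _ (nbhsx_ballx _ s s0).
rewrite -ball_normE /= => vw.
have vd : `|0 - vdisp A B| <= d by rewrite -fe; apply/hv/subset_closure.
have wd : `|0 - w| <= d + s.
  by apply: le_trans (norm_dist_triangle (vdisp A B) _ _) _; lra.
have := near_minimizers_close (convex_setdiff cA cB) Dw Dfe d0 hD wd _.
rewrite fe lerDl => /(_ (ltW s0)) wfe.
have : `|w - (f - e)| < r / 2.
  rewrite -ltr_sqr ?nnegrE//; last by lra.
  rewrite exprMn exprVn; nra.
have := norm_dist_triangle w (vdisp A B) (f - e); rewrite -/r; lra.
Qed.

(** * One step of the perturbed iteration *)

Lemma nearest_nonexpansive C x y p q : Defs.convex_set C -> is_nearest C x p ->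
  is_nearest C y q -> `|p - q| <= `|x - y|.
Proof.
move=> cC xp yq; rewrite -ler_sqr ?nnegrE//.
by apply: le_trans (nearest_firmly_nonexpansive cC xp yq) _;
   rewrite gerBl exprn_ge0.
Qed.

(** Firm nonexpansiveness on [D], for [b] and [f], gains the squared gap; the errors from [p] and
    [q] cost a multiple of [eta * |x - e|] and of [eta ^+ 2], which the last two hypotheses
    dominate. *)
Lemma alternating_step_decrease C D x e f b a p q (eta : R) :
  Defs.convex_set C -> Defs.convex_set D ->
  is_nearest C e p -> is_nearest D f q -> is_nearest C x b -> is_nearest D b a ->
  `|p - f| <= eta -> `|q - e| <= eta -> 0 < eta ->
  8 * eta <= `|(b - a) - (f - e)| ->
  24 * (eta * `|x - e|) <= `|(b - a) - (f - e)| ^+ 2 ->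
  `|a - e| <= `|x - e| - eta.
Proof.
move=> cC cD ep fq xb ba pf qe eta0.
have bf : `|b - f| <= `|x - e| + eta.
  have := nearest_nonexpansive cC xb ep; have := norm_dist_triangle p b f; lra.
have := nearest_firmly_nonexpansive cD ba fq.
have gap : `|(b - a) - (f - e)| <= `|(b - a) - (f - q)| + eta.
  apply: le_trans (norm_dist_triangle (f - q) _ _) _; rewrite lerD2l.
  by rewrite opprB addrCA addrAC subrr add0r distrC.
(* A decrease of [2 * eta] is sought for |a - q|, as replacing [q] by [e] costs one [eta]. *)
suff : 8 * eta <= `|b - a - (f - e)| ->
    24 * (eta * `|x - e|) <= `|b - a - (f - e)| ^+ 2 ->
    `|a - q| ^+ 2 <= `|b - f| ^+ 2 - `|b - a - (f - q)| ^+ 2 ->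
    `|a - q| <= `|x - e| - 2 * eta.
  have := norm_dist_triangle q a e; move=> h1 h2 h3 h4 h5.
  by have := h2 h4 h5 h3; lra.
move: (normr_ge0 (x - e)) (normr_ge0 (b - f)) (normr_ge0 (a - q)) bf gap.
move: `|x - e| `|b - f| `|a - q| `|b - a - (f - e)| `|b - a - (f - q)|.
move=> r s n g h r0 s0 n0 sr gh g8 g24 nsh; rewrite leNgt; apply/negP => rn.
have h78 : 7 / 8 * g <= h by lra.
have s2 : s ^+ 2 <= (r + eta) ^+ 2 by rewrite ler_sqr ?nnegrE//; lra.
have h2 : (7 / 8 * g) ^+ 2 <= h ^+ 2 by rewrite ler_sqr ?nnegrE//; lra.
(* Squaring [r - 2 * eta < n] requires a nonnegative left side; for smaller [r] the gap alone would
   make [n ^+ 2] negative. *)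
have [r2|r2] := lerP (2 * eta) r.
  have : (r - 2 * eta) ^+ 2 < n ^+ 2 by rewrite ltr_sqr ?nnegrE//; lra.
  nra.
have : (r + eta) ^+ 2 <= (3 * eta) ^+ 2 by rewrite ler_sqr ?nnegrE//; lra.
have : (8 * eta) ^+ 2 <= g ^+ 2 by rewrite ler_sqr ?nnegrE//; lra.
have := exprn_ge0 2 n0; have : 0 < eta ^+ 2 by exact: exprn_gt0.
rewrite !exprMn in h2 *; nra.
Qed.

Lemma convex_combB (t : R) u w : t *: u + (1 - t) *: w - w = t *: (u - w).
Proof.
by rewrite scalerBl scale1r scalerBr addrA addrAC addrK.
Qed.

Lemma convex_combBl (t : R) u w w' :
  (t *: u + (1 - t) *: w) - (t *: u + (1 - t) *: w') = (1 - t) *: (w - w').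
Proof. by rewrite opprD addrACA subrr add0r -scalerBr. Qed.

(* Contracting [a] towards [e] by the factor [t] brings the iterate into a
   bounded region, where Attouch-Wets closeness and regularity apply; this is
   what controls the iterates before they are known to be bounded. *)
Lemma perturbed_step (A B : set X) (As Bs : nat -> set X) (M K eps : R) :
  ccn A -> ccn B -> (forall e, Eset A B e -> `|e| <= M) -> regular A B ->
  (forall n, ccn (As n)) -> (forall n, ccn (Bs n)) ->
  AW_cvg As A -> AW_cvg Bs B -> 0 <= M -> 0 <= K -> 0 < eps ->
  exists eta, [/\ 0 < eta, eta <= eps & \forall n \near \oo, forall e t x b a,
    Eset A B e -> 0 < t -> t <= 1 -> t * `|x - e| <= K ->
    is_nearest (Bs n) x b -> is_nearest (As n) b a ->
    `|b - (e + vdisp A B)| <= `|x - e| + eta /\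
    (`|a - e| <= `|x - e| - eta \/
     distp (t *: a + (1 - t) *: e) (Eset A B) <= eps)].
Proof.
move=> hA hB EM hreg hAs hBs AsA BsB M0 K0 eps0; set v := vdisp A B.
have [delta delta0 hdelta] := hreg eps eps0.
pose T := delta / 2; have T0 : 0 < T by rewrite divr_gt0.
have min0 : 0 < Num.min eps (Num.min (delta / 16) (T ^+ 2)).
  by rewrite !lt_min eps0 divr_gt0 ?exprn_gt0.
have [|eta [eta0 eta1 + +]] := @small_scale R (24 * (K + 1)) _ _ min0; first lra.
rewrite !le_min => /and3P[eta_eps eta_delta _] /and3P[_ _ eta_T].
(* [L] bounds the scaled points [y] and [z] below; its summand 2 covers two errors [eta <= 1]. *)
exists eta; split=> //; pose L := M + `|v| + K + 2.
have v0 := normr_ge0 v; have Mv : 0 <= M + `|v| by lra.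
have A0 : A !=set0 by case: hA.
have B0 : B !=set0 by case: hB.
have As0 n : As n !=set0 by case: (hAs n).
have Bs0 n : Bs n !=set0 by case: (hBs n).
have near_PB := projection_AW hB hBs BsB Mv eta0.
have near_PA := projection_AW hA hAs AsA Mv eta0.
have near_A := AW_cvg_near L A0 As0 AsA eta0.
have near_B := AW_cvg_near L B0 Bs0 BsB eta0.
apply: filterS2 (filterI near_PB near_PA) (filterI near_A near_B).
move=> n [PB PA] [[AsnA _] [BsnB _]] e t x b a Ee t0 t1 xeK xb ba.
have [_ cAn _] := hAs n; have [_ cBn _] := hBs n.
have [ef fe _] := Eset_vdisp hA hB Ee; rewrite -/v in ef fe *.
set f := e + v in ef fe *.
have eM := EM _ Ee.
have fM : `|f| <= M + `|v| by apply: le_trans (ler_normD _ _) _; lra.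
have [p hp] := nearest_exists e (hBs n); have [q hq] := nearest_exists f (hAs n).
have pf : `|p - f| <= eta by apply: (PB e) => //; lra.
have qe : `|q - e| <= eta by apply: (PA f) => //; lra.
have bp := nearest_nonexpansive cBn xb hp; have aq := nearest_nonexpansive cAn ba hq.
have bf : `|b - f| <= `|x - e| + eta by have := norm_dist_triangle p b f; lra.
split=> //; have fev : f - e = v by rewrite /f addrC addKr.
(* A scaled gap of at least [T] forces decrease: [8 * eta <= T], and 24 eta K <= T^2 gives the
   quadratic condition multiplied by [t]. *)
have [far|near_v] := lerP T (t * `|b - a - (f - e)|).
  left; apply: (alternating_step_decrease cBn cAn hp hq xb ba pf qe eta0).
    rewrite /T in far; have := normr_ge0 (b - a - (f - e)); nra.
  rewrite -(ler_pM2l t0).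
  have : T ^+ 2 <= t ^+ 2 * `|b - a - (f - e)| ^+ 2.
    by rewrite -exprMn ler_sqr ?nnegrE//; nra.
  have := exprn_ge0 2 (normr_ge0 (b - a - (f - e))).
  have := normr_ge0 (x - e).
  move: (`|b - a - (f - e)| ^+ 2) `|x - e| xeK => G r rK r0 G0 TG.
  have : t ^+ 2 * G <= t * G by rewrite ler_wpM2r ?expr2 ?ger_pMl.
  by have := ler_wpM2l (ltW eta0) rK; lra.
right; apply: hdelta.
set y' := t *: a + _.
have Bf : B f by case: ef.
(* [e] and [f] may lie outside the perturbed sets, so the convex combinations use their projections
   [q] and [p], at a cost of at most [eta]. *)
have As_y : As n (t *: a + (1 - t) *: q).
  by apply: cAn => //; [case: ba | case: hq | exact: ltW].
have Bs_z : Bs n (t *: b + (1 - t) *: p).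
  by apply: cBn => //; [case: xb | case: hp | exact: ltW].
set y := t *: a + (1 - t) *: q in As_y; set z := t *: b + (1 - t) *: p in Bs_z.
have yq : `|y - q| = t * `|a - q| by rewrite convex_combB normrZ gtr0_norm.
have zp : `|z - p| = t * `|b - p| by rewrite convex_combB normrZ gtr0_norm.
have [y1 Ay1 yy1] : exists2 y1, A y1 & `|y - y1| <= eta.
  apply: AsnA => //; have := norm_dist_triangle q y 0.
  by have := norm_dist_triangle e q 0; rewrite !subr0 /L; nra.
have [z1 Bz1 zz1] : exists2 z1, B z1 & `|z - z1| <= eta.
  apply: BsnB => //; have := norm_dist_triangle p z 0.
  by have := norm_dist_triangle f p 0; rewrite !subr0 /L; nra.
have y'y : `|y' - y| <= eta.
  rewrite convex_combBl normrZ ger0_norm ?subr_ge0// distrC.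
  have := normr_ge0 (q - e); nra.
pose z' := t *: b + (1 - t) *: f.
have z'z : `|z' - z| <= eta.
  rewrite convex_combBl normrZ ger0_norm ?subr_ge0// distrC.
  have := normr_ge0 (p - f); nra.
rewrite ge_max; apply/andP; split.
  apply: le_trans (distp_le y' Ay1) _.
  by apply: le_trans (norm_dist_triangle y _ _) _; lra.
have Bv : translate B v (z1 - v) by exists z1.
apply: le_trans (distp_le y' Bv) _.
(* Since [f - e = v], the gap of the scaled pair minus [v] is exactly [t] times the original one. *)
have y'z' : `|y' - (z' - v)| = t * `|b - a - (f - e)|.
  rewrite -(gtr0_norm t0) -normrZ distrC -convex_combB fev; congr `|_|.
  by rewrite addrAC /z' /y' opprD addrACA -!scalerBr fev.
have z1v : `|(z' - v) - (z1 - v)| <= 2 * eta.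
  rewrite opprB addrA subrK.
  by apply: le_trans (norm_dist_triangle z _ _) _; lra.
apply: le_trans (norm_dist_triangle (z' - v) _ _) _; rewrite /T in near_v; lra.
Qed.

End Hilbert.

(** * From step decrease to boundedness and convergence *)

(** Above [c] the sequence loses [k] per step, so it falls to [c] in finitely many steps and then
    stays there. *)
Lemma eventually_le_of_step_decrease {R : realType} (u : nat -> R) (c k : R) :
  0 < k -> (\forall n \near \oo, u n.+1 <= Num.max c (u n - k)) ->
  \forall n \near \oo, u n <= c.
Proof.
move=> k0 [N _ hN].
have bound j : u (N + j)%N <= Num.max c (u N - k *+ j).
  elim: j => [|j IH]; first by rewrite addn0 mulr0n subr0 le_max lexx orbT.
  have := hN (N + j)%N (leq_addr _ _); rewrite addnS /= => /le_trans; apply.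
  rewrite ge_max le_max lexx /= mulrSr opprD addrA.
  move: IH; rewrite !le_max => /orP[h|h]; apply/orP; [left|right]; lra.
exists (N + (Num.truncn ((u N - c) / k)).+1)%N => // n /= Nn.
have := bound (n - N)%N; rewrite subnKC; last exact: leq_trans (leq_addr _ _) Nn.
rewrite le_max => /orP[//|/le_trans]; apply.
rewrite lerBlDl -lerBlDr -mulr_natr mulrC -ler_pdivrMr//.
apply: le_trans (ltW (truncnS_gt _)) _.
by rewrite ler_nat leq_subRL//; exact: leq_trans (leq_addr _ _) Nn.
Qed.

Theorem theorem4p10 (R : realType) (X : completeNormedModType R)
  (ip : X -> X -> R) (hip : is_inner_product ip)
  (A B : set X) (hA : ccn A) (hB : ccn B)
  (hE : Eset A B !=set0) (hF : Fset A B !=set0)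
  (hEb : bounded_set (Eset A B)) (hFb : bounded_set (Fset A B))
  (hreg : regular A B) :
  d_stable A B.
Proof.
move=> As Bs hAs hBs AsA BsB a0 a b [_ hab].
have xb n : is_nearest (Bs n.+1) (a n) (b n.+1).
  by rewrite (hab n).1; exact: (projP hip).
have ba n : is_nearest (As n.+1) (b n.+1) (a n.+1).
  by rewrite (hab n).2; exact: (projP hip).
have [M [_ EM]] := hEb.
(* [bounded_set] gives bounds only strictly above [M]; the maximum makes this one nonnegative. *)
have {}EM e : Eset A B e -> `|e| <= Num.max M 0 + 1.
  by apply: EM; rewrite ltr_pwDr// le_max lexx.
set M' := Num.max M 0 + 1 in EM.
have M0 : 0 <= M' by rewrite addr_ge0// le_max lexx orbT.
(* A scaled iterate within 2 of a point of E is within 2M' + 2 = K - 2 of [e0], which leaves a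
   margin of 2. *)
have [e0 Ee0] := hE; pose K := 2 * M' + 4; have K0 : 0 < K by rewrite /K; lra.
have diamE e : Eset A B e -> `|e - e0| <= 2 * M'.
  by move=> Ee; have := ler_normB e e0; have := EM _ Ee; have := EM _ Ee0; lra.
have bounded_a : \forall n \near \oo, `|a n - e0| <= K.
  have [eta [eta0 eta1 [N _ hN]]] := perturbed_step hip hA hB EM hreg hAs hBs
    AsA BsB M0 (ltW K0) ltr01.
  apply: (eventually_le_of_step_decrease eta0); exists N => // n /= Nn.
  rewrite le_max; apply/orP.
  have step t : 0 < t -> t <= 1 -> t * `|a n - e0| <= K ->
      `|a n.+1 - e0| <= `|a n - e0| - eta \/ t * `|a n.+1 - e0| <= K - 2.
    move=> t0 t1 tK.
    have [_ [|yE]] := hN n.+1 (leqW Nn) e0 t _ _ _ Ee0 t0 t1 tK (xb n) (ba n).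
      by left.
    right; have [e Ee ye] := distp_adherent (t *: a n.+1 + (1 - t) *: e0) hE (@ltr01 R).
    rewrite -(gtr0_norm t0) -normrZ -convex_combB.
    apply: le_trans (norm_dist_triangle e _ _) _.
    by have := diamE _ Ee; rewrite /K; move: ye yE; lra.
  have [aK|aK] := lerP `|a n - e0| K.
    have [//||h|h] := step 1 ltr01; [by rewrite mul1r | by right | left].
    by move: h; rewrite mul1r; lra.
  have an0 : 0 < `|a n - e0| by exact: lt_trans aK.
  (* This scaling puts [a n] at distance exactly [K]; the margin 2, divided by [t <= 1], is a
     decrease of at least [eta]. *)
  right; pose t := K / `|a n - e0|.
  have t0 : 0 < t by exact: divr_gt0.
  have t1 : t <= 1 by rewrite ler_pdivrMr// mul1r ltW.
  have tK : t * `|a n - e0| = K by rewrite divfK// gt_eqF.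
  have [|//|h] := step t t0 t1; first by rewrite tK.
  move: h; rewrite -tK; nra.
have limits (eps : R) : 0 < eps -> \forall n \near \oo,
    distp (a n) (Eset A B) <= eps /\ distp (b n.+1) (Fset A B) <= 3 * eps.
  move=> eps0; have K2 : 0 <= K + 2 * M' by lra.
  have [eta [eta0 eta_eps [N _ hN]]] := perturbed_step hip hA hB EM hreg hAs hBs
    AsA BsB M0 K2 eps0.
  (* [e] is only nearest in E up to [eta / 2], so half of the decrease [eta] survives for the
     distance to E. *)
  have eta2 : 0 < eta / 2 by lra.
  have step n : (N <= n)%N -> `|a n - e0| <= K ->
      distp (a n.+1) (Eset A B) <= Num.max eps (distp (a n) (Eset A B) - eta / 2) /\
      distp (b n.+1) (Fset A B) <= distp (a n) (Eset A B) + 2 * eta.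
    move=> Nn anK; have [e Ee ane] := distp_adherent (a n) hE eta2.
    have [_ _ Ff] := Eset_vdisp hip hA hB Ee.
    have tK : 1 * `|a n - e| <= K + 2 * M'.
      rewrite mul1r; have := norm_dist_triangle e0 (a n) e.
      by have := diamE _ Ee; rewrite distrC; lra.
    have [bf ae] := hN n.+1 (leqW Nn) e 1 _ _ _ Ee ltr01 (lexx _) tK (xb n) (ba n).
    split; last by have := distp_le (b n.+1) Ff; lra.
    rewrite le_max; apply/orP; case: ae => [ae|].
      by right; have := distp_le (a n.+1) Ee; lra.
    by rewrite subrr scale0r addr0 scale1r; left.
  have N_le : \forall n \near \oo, (N <= n)%N by exists N.
  have le_eps : \forall n \near \oo, distp (a n) (Eset A B) <= eps.
    apply: (eventually_le_of_step_decrease eta2).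
    by apply: filterS2 N_le bounded_a => n Nn aK; have [] := step n Nn aK.
  apply: filterS3 N_le bounded_a le_eps => n Nn aK aE; split=> //.
  by have [_] := step n Nn aK; lra.
(* The bounds concern [b n.+1], so the limit of [b] is read off the shifted sequence. *)
split; last rewrite -cvg_shiftS; apply/cvgrPdist_le => eps eps0.
  apply: filterS (limits _ eps0) => n [aE _].
  by rewrite sub0r normrN ger0_norm ?distp_ge0.
have eps3 : 0 < eps / 3 by lra.
apply: filterS (limits _ eps3) => n [_ bF].
by rewrite sub0r normrN ger0_norm ?distp_ge0//=; lra.
Qed.
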